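(* Let $\alpha>0$, let $I_1,I_2,\dots\subset[-\alpha,\alpha]$ be a (finite or countably infinite) collection of disjoint nonempty open intervals, let $K=[-\alpha,\alpha]\setminus\bigcup_iI_i$, and let $\Lambda_K\subset\mathbb{H}$ be the associated surface (defined in the context). For integers $n>\sqrt\alpha$, let $K_n=n^{-2}K$, regarded as a subset of $S^1\cong(-\pi,\pi]$, let $\Sigma_{K_n}$ be the associated surface (defined in the context), and let $S_n=s_{n^{-1},n}(\Sigma_{K_n})$. Let $S_n^+$ and $\Lambda_K^+$ be the half-spaces (epigraphs) bounded by $S_n$ and $\Lambda_K$. Then $\mathbf{1}_{S_n^+}\to\mathbf{1}_{\Lambda_K^+}$ in $L_1^{\mathrm{loc}}(\mathbb{H})$ as $n\to\infty$.
   Context: Heisenberg group: $\mathbb{H}=\mathbb{R}^3$ with $(x,y,z)\cdot(x',y',z')=(x+x',y+y',z+z'+\frac{xy'-yx'}{2})$, equipped with Lebesgue measure. $Y^t=(0,t,0)$. Stretch automorphism: $s_{a,b}(x,y,z)=(ax,by,abz)$. Definition of $\Lambda_K$. The positive horizontal ray from $p$ with slope $\sigma$ is $\{p\cdot(t,\sigma t,0):t\ge0\}$. Write $I_i=(a_i,b_i)$, $m_i=\frac{a_i+b_i}2$. $\Lambda_K$ is the union of: the negative $x$-axis $R_0$; for each $k\in K$ the positive horizontal ray from the origin with slope $k$; for each $i\ge1$ the positive horizontal ray $R_i$ from the origin with slope $m_i$; for each $p\in R_0$ the positive horizontal rays from $p$ with slopes $\pm\alpha$; for each $i\ge1$ and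 $p\in R_i$ the positive horizontal rays from $p$ with slopes $a_i$ and $b_i$. (It depends only on $K$, since $\alpha=\sup K$.) Definition of $\Sigma_{K'}$. Let $S^1$ be the unit circle of horizontal vectors, identified with $(-\pi,\pi]$ via $\theta\mapsto(\cos\theta,\sin\theta,0)$, so that the positive $x$-direction is $0$. The horizontal ray from $p$ in direction $\theta$ is $\{p\cdot(t\cos\theta,t\sin\theta,0):t\ge0\}$. Let $K'\subset S^1$ be the complement of a (finite or countable) collection of disjoint nonempty open arcs $J_i=(a_i',b_i')$, each of length $<2\pi$, with midpoints $m_i'$. $\Sigma_{K'}$ is the union of: for each $k\in K'$, the horizontal ray from the origin in direction $k$; for each $i$, the horizontal ray $R_i'$ from the origin in direction $m_i'$; and for each $i$ and $p\in R_i'$, the horizontal rays from $p$ in the directions $a_i'$ and $b_i'$. (For $K'=K_n$ the arcs are $n^{-2}I_i$ together with the arc from $n^{-2}\alpha$ through $\pi$ to $-n^{-2}\alpha$.) For a set $S\subset\mathbb{H}$ meeting each coset $v\cdot\{Y^t:t\in\mathbb R\}$ in exactly one point (an entire intrinsic graph, as $S_n$ and $\Lambda_K$ are), its epigraph is $S^+=\{pY^t:p\in S,\ t\ge0\}$. *)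

(* Defs.v *)
From HB Require Import structures.
From mathcomp Require Import all_boot all_order all_algebra.
From mathcomp Require Import all_classical all_reals all_analysis.
From mathcomp Require Import zify ring lra.
Import Order.TTheory GRing.Theory Num.Theory.
Import numFieldNormedType.Exports.

Set Implicit Arguments.
Unset Strict Implicit.
Unset Printing Implicit Defensive.

Local Open Scope classical_set_scope.
Local Open Scope ring_scope.

Section Heisenberg.
Context {R : realType}.
Implicit Types (p q : R * R * R) (S : set (R * R * R)).

Definition hmul p q : R * R * R :=
  (p.1.1 + q.1.1, p.1.2 + q.1.2,
   p.2 + q.2 + (p.1.1 * q.1.2 - p.1.2 * q.1.1) / 2).

Definition horigin : R * R * R := (0, 0, 0).

Definition Ypow (t : R) : R * R * R := (0, t, 0).

Definition stretch (a b : R) p : R * R * R :=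
  (a * p.1.1, b * p.1.2, a * b * p.2).

Definition slope_ray p (sigma : R) : set (R * R * R) :=
  [set hmul p (t, sigma * t, 0) | t in `[0, +oo[].

Definition angle_ray p (theta : R) : set (R * R * R) :=
  [set hmul p (t * cos theta, t * sin theta, 0) | t in `[0, +oo[].

Definition epigraph S : set (R * R * R) :=
  [set hmul p (Ypow t) | p in S & t in `[0, +oo[].

Definition midpoint (a b : R) : R := (a + b) / 2.

Definition neg_x_axis : set (R * R * R) := [set (x, 0, 0) | x in `]-oo, 0]].

Definition gap_complement (I : Type) (alpha : R) (a b : I -> R) : set R :=
  [set` `[- alpha, alpha]] `\` \bigcup_i [set` `]a i, b i[].

Definition Lambda (I : Type) (alpha : R) (a b : I -> R) : set (R * R * R) :=
  neg_x_axis
  `|` \bigcup_(k in gap_complement alpha a b) slope_ray horigin k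
  `|` \bigcup_i slope_ray horigin (midpoint (a i) (b i))
  `|` \bigcup_(p in neg_x_axis) (slope_ray p alpha `|` slope_ray p (- alpha))
  `|` \bigcup_i \bigcup_(p in slope_ray horigin (midpoint (a i) (b i)))
        (slope_ray p (a i) `|` slope_ray p (b i)).

(* The unit circle, as the set of angles ]-pi, pi]. *)
Definition circle : set R := [set` `]- pi, pi]].

(* An open arc is given by a lift ]a, b[ of it to the real line, so that its
   midpoint is the direction of angle (a + b) / 2. *)
Definition arc (a b : R) : set R :=
  circle `&` [set theta | exists k : int, a < theta + k%:~R * (2 * pi) < b].

Definition is_arc_complement (J : Type) (K' : set R) (a' b' : J -> R) : Prop :=
  [/\ forall j, a' j < b' j < a' j + 2 * pi,
      trivIset setT (fun j => arc (a' j) (b' j)) &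
      K' = circle `\` \bigcup_j arc (a' j) (b' j)].

(* This is Sigma_{K'} when [is_arc_complement K' a' b'] holds; for the
   surfaces Sn below this is lemma [Kscaled_arc_complement]. *)
Definition Sigma (J : Type) (K' : set R) (a' b' : J -> R) : set (R * R * R) :=
  \bigcup_(k in K') angle_ray horigin k
  `|` \bigcup_j angle_ray horigin (midpoint (a' j) (b' j))
  `|` \bigcup_j \bigcup_(p in angle_ray horigin (midpoint (a' j) (b' j)))
        (angle_ray p (a' j) `|` angle_ray p (b' j)).

Section Rescaled.
Context {I : Type} (alpha : R) (a b : I -> R) (n : nat).

Definition Kscaled : set R :=
  [set k / n%:R ^+ 2 | k in gap_complement alpha a b].

(* [None] stands for the arc from alpha / n ^ 2 through pi to - alpha / n ^ 2. *)
Definition arc_left (j : option I) : R :=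
  if j is Some i then a i / n%:R ^+ 2 else alpha / n%:R ^+ 2.

Definition arc_right (j : option I) : R :=
  if j is Some i then b i / n%:R ^+ 2 else 2 * pi - alpha / n%:R ^+ 2.

Definition Sn : set (R * R * R) :=
  stretch n%:R^-1 n%:R @` Sigma Kscaled arc_left arc_right.

End Rescaled.

Lemma arc_small (x y : R) : - pi <= x -> y <= pi -> arc x y = [set` `]x, y[].
Proof.
move=> xpi ypi; have pi0 := @pi_gt0 R.
apply/seteqP; split=> t; rewrite /arc /circle /= !in_itv /=.
  move=> [/andP[t1 t2] [k /andP[k1 k2]]].
  have [k0|k0] := lerP 1 k.
    have : (1%:~R : R) <= k%:~R by rewrite ler_int.
    move: (k%:~R : R) k1 k2 => r k1 k2 r1.
    by exfalso; have : 0 <= (r - 1) * pi by [apply: mulr_ge0; lra]; lra.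
  have [k0'|k0'] := lerP k (-1).
    have : k%:~R <= ((-1)%:~R : R) by rewrite ler_int.
    rewrite rmorphN1.
    move: (k%:~R : R) k1 k2 => r k1 k2 r1.
    by exfalso; have : 0 <= (-1 - r) * pi by [apply: mulr_ge0; lra]; lra.
  have k00 : k = 0 by lia.
  by move: k1 k2; rewrite k00 mul0r addr0 => -> ->.
move=> /andP[t1 t2]; split; first by apply/andP; split; lra.
by exists 0; rewrite mul0r addr0 t1.
Qed.

Lemma arc_through_pi (c : R) : 0 < c < pi ->
  arc c (2 * pi - c) = circle `\` [set` `[- c, c]].
Proof.
move=> /andP[c0 cpi].
apply/seteqP; split=> t; rewrite /arc /circle /= !in_itv /=.
  move=> [/andP[t1 t2] [k /andP[k1 k2]]].
  split; first by rewrite t1.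
  move=> /andP[t3 t4].
  have [k0|k0] := lerP 1 k.
    have : (1%:~R : R) <= k%:~R by rewrite ler_int.
    move: (k%:~R : R) k1 k2 => r k1 k2 r1.
    by have : 0 <= (r - 1) * pi by [apply: mulr_ge0; lra]; lra.
  have : k%:~R <= (0%:~R : R) by rewrite ler_int; lia.
  move: (k%:~R : R) k1 k2 => r k1 k2 r1.
  by have : 0 <= - r * pi by [apply: mulr_ge0; lra]; lra.
move=> -[/andP[t1 t2] tc]; split; first by rewrite t1.
have [ct|tc'] := ltP c t.
  by exists 0; rewrite mul0r addr0; apply/andP; split; lra.
exists 1; rewrite mul1r.
have : t < - c by rewrite ltNge; apply/negP => h; apply: tc; rewrite h.
by move=> h; apply/andP; split; lra.
Qed.

Lemma Kscaled_arc_complement (I : Type) (alpha : R) (a b : I -> R) (n : nat) :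
  0 < alpha -> (forall i, a i < b i) ->
  (forall i, [set` `]a i, b i[] `<=` [set` `[- alpha, alpha]]) ->
  trivIset setT (fun i => [set` `]a i, b i[]) ->
  Num.sqrt alpha < n%:R ->
  is_arc_complement (Kscaled alpha a b n) (arc_left alpha a n)
    (arc_right alpha b n).
Proof.
move=> al0 ab sub triv nal.
have pi2 := @pi_ge2 R.
set N : R := n%:R ^+ 2.
have alN : alpha < N.
  rewrite -(sqr_sqrtr (ltW al0)) /N ltr_pXn2r // nnegrE ?sqrtr_ge0 //.
have N0 : 0 < N by lra.
have N1 : 0 < N^-1 by rewrite invr_gt0.
have itvN (x y t : R) : (t \in `]x / N, y / N[) = (t * N \in `]x, y[).
  by rewrite !in_itv /= ltr_pdivrMr // ltr_pdivlMr.
have itvcN (t : R) :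
    (t \in `[- (alpha / N), alpha / N]) = (t * N \in `[- alpha, alpha]).
  by rewrite -mulNr !in_itv /= ler_pdivrMr // ler_pdivlMr.
have c0 : 0 < alpha / N by apply: divr_gt0.
have c1 : alpha / N < 1 by rewrite ltr_pdivrMr // mul1r.
have bnd i : - alpha <= a i /\ b i <= alpha.
  have abi := ab i; split; rewrite leNgt; apply/negP => h.
    have [m|m] := leP (- alpha) (b i).
      have /sub : [set` `]a i, b i[] ((a i - alpha) / 2).
        by rewrite /= in_itv /=; apply/andP; split; lra.
      by rewrite /= in_itv /= => /andP[]; lra.
    have /sub : [set` `]a i, b i[] ((a i + b i) / 2).
      by rewrite /= in_itv /=; apply/andP; split; lra.
    by rewrite /= in_itv /= => /andP[]; lra.
  have [m|m] := leP (a i) alpha.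
    have /sub : [set` `]a i, b i[] ((b i + alpha) / 2).
      by rewrite /= in_itv /=; apply/andP; split; lra.
    by rewrite /= in_itv /= => /andP[]; lra.
  have /sub : [set` `]a i, b i[] ((a i + b i) / 2).
    by rewrite /= in_itv /=; apply/andP; split; lra.
  by rewrite /= in_itv /= => /andP[]; lra.
have bndN i : - (alpha / N) <= a i / N /\ b i / N <= alpha / N.
  by have [? ?] := bnd i; rewrite -mulNr !ler_pM2r.
have arcS i : arc (a i / N) (b i / N) = [set` `]a i / N, b i / N[].
  by have [? ?] := bndN i; apply: arc_small; lra.
have arcN : arc (alpha / N) (2 * pi - alpha / N) =
    circle `\` [set` `[- (alpha / N), alpha / N]].
  by apply: arc_through_pi; apply/andP; split; lra.
have disj i t : arc (a i / N) (b i / N) t ->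
    arc (alpha / N) (2 * pi - alpha / N) t -> False.
  rewrite arcS arcN /= itvN => ti [_]; apply.
  by rewrite itvcN; exact: (sub i).
split.
- move=> [i|] /=; rewrite -/N; last by apply/andP; split; lra.
  have [? ?] := bndN i; rewrite -/N; apply/andP; split; last by lra.
  by rewrite ltr_pM2r.
- move=> [i|] [j|] _ _ [t [/= t1 t2]] //.
  + congr Some; apply: triv => //; exists (t * N).
    by move: t1 t2; rewrite -/N !arcS /= !itvN.
  + by case: (disj i t).
  + by case: (disj j t).
apply/seteqP; split=> t.
  move=> [k [/= kal knot] <-]; rewrite -/N.
  have kN : k / N * N = k by rewrite divfK // gt_eqF.
  have : k / N \in `[- (alpha / N), alpha / N] by rewrite itvcN kN.
  rewrite in_itv /= => /andP[h1 h2].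
  split; first by rewrite /circle /= in_itv /=; apply/andP; split; lra.
  move=> [[i|] _] /=; rewrite -/N.
    by rewrite arcS /= itvN kN => ki; apply: knot; exists i.
  by rewrite arcN /= => -[_]; apply; rewrite itvcN kN.
move=> [tc tnot]; exists (t * N); last by rewrite -/N mulfK // gt_eqF.
split=> /=.
  rewrite -itvcN; apply/negPn/negP => h; apply: tnot; exists None => //=.
  by rewrite -/N arcN; split => //=; exact/negP.
move=> [i _ /= ti]; apply: tnot; exists (Some i) => //=.
by rewrite -/N arcS /= itvN.
Qed.

Definition heis_measure :=
  ((@lebesgue_measure R \x @lebesgue_measure R) \x @lebesgue_measure R)%E.

(* Measurability of f is part of [integrable]. *)
Definition locally_L1 (f : R * R * R -> R) : Prop :=
  forall C : set (R * R * R), compact C ->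
    heis_measure.-integrable C (EFin \o f).

Definition cvg_L1loc (f_ : nat -> R * R * R -> R) (f : R * R * R -> R) : Prop :=
  forall C : set (R * R * R), compact C ->
    (\int[heis_measure]_(p in C) (`|f_ n p - f p|%:E))%E @[n --> \oo] --> 0%E.

End Heisenberg.

(* Main.v *)
(* For a point (x, y, z), the numbers x and u = x y - 2 z are constant on the
   cosets of the y-axis, and a horizontal ray of slope s starting at
   (x0, y0, z0) is the curve y = y0 + s t, u = u0 + 2 y0 t + s t^2 over
   x = x0 + t.  In the coordinates (x, y, u) the surface is therefore a graph
   u = H (x, y): for x > 0 it is homogeneous, H (x, y) = x^2 psi (y / x), where
   psi is the identity on K and two half-parabolas on each gap of K, and
   elsewhere it consists of the half-parabolas y |y| / alpha.  As H is
   nondecreasing and onto in y, the epigraph is {x y - 2 z <= H (x, y)}, and its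
   boundary meets each vertical line in a single point, so it is null.

   The stretch maps rays of angle theta with cos theta > 0 to rays of slope
   n^2 tan theta, so S_n is a surface of the same kind, with every slope k
   replaced by n^2 tan (k / n^2), which tends to k.  The functions psi_n then
   converge pointwise to psi, and dominated convergence concludes. *)
Require Import Defs.
From mathcomp Require Import all_boot all_order all_algebra.
From mathcomp Require Import all_classical all_reals all_analysis.
From mathcomp Require Import measurable_realfun ring lra.
Import Order.TTheory GRing.Theory Num.Theory.
Import numFieldNormedType.Exports.
Local Open Scope classical_set_scope.
Local Open Scope ring_scope.

Set Implicit Arguments.
Unset Strict Implicit.
Unset Printing Implicit Defensive.

(** * Measurability, null sets and convergence of indicators in the Heisenberg group *)

Section HeisMeasure.
Context {R : realType}.
Notation T3 := (measurableTypeR R * measurableTypeR R * measurableTypeR R)%type.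

(** Measurability refers to the product sigma-algebra, so an open set is exhausted by the countably
    many rational boxes contained in it. *)
Lemma open_measurable3 (A : set (R * R * R)) : open A -> measurable (A : set T3).
Proof.
move=> oA.
pose box (q : (rat * rat) * (rat * rat) * (rat * rat)) : set T3 :=
  ([set` `]ratr q.1.1.1, ratr q.1.1.2[] `*` [set` `]ratr q.1.2.1, ratr q.1.2.2[])
  `*` [set` `]ratr q.2.1, ratr q.2.2[].
pose F q : set T3 := [set p | box q p /\ box q `<=` A].
have -> : (A : set T3) = \bigcup_q F q.
  apply/seteqP; split=> [[[x y] z] Ap|p [q _]]; last first.
    by case=> pq; exact.
  have /nbhs_ballP[e /= e0 he] : nbhs (x, y, z) A by exact: open_nbhs_nbhs.
  have rat_around (c : R) : exists q : rat * rat,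
      (c \in `]ratr q.1, ratr q.2[) /\
      forall t : R, t \in `]ratr q.1, ratr q.2[ -> `|c - t| < e.
    have /rat_in_itvoo[q1] : c - e < c by lra.
    have /rat_in_itvoo[q2] : c < c + e by lra.
    rewrite !in_itv /= => /andP[? ?] /andP[? ?].
    exists (q1, q2); split=> [|t]; rewrite in_itv /=; first by apply/andP.
    by move=> /andP[? ?]; rewrite ltr_norml; apply/andP; split; lra.
  have [qx [qx1 qx2]] := rat_around x.
  have [qy [qy1 qy2]] := rat_around y.
  have [qz [qz1 qz2]] := rat_around z.
  exists (qx, qy, qz) => //; split=> // -[[x' y'] z'] /= [[/= ? ?] ?]; apply: he.
  by split; [split|]; rewrite /ball /= /ball_ /=; auto.
apply: countable_bigcupT_measurable => [|q]; first exact: countableP.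
have [qA|qA] := pselect (box q `<=` A); last first.
  by rewrite (_ : F q = set0) //; apply/seteqP; split=> // p [].
rewrite (_ : F q = box q); last by apply/seteqP; split=> // p [].
by apply: measurableX; [apply: measurableX|]; exact: measurable_itv.
Qed.

Lemma compact_measurable3 (C : set (R * R * R)) :
  compact C -> measurable (C : set T3).
Proof.
move=> /(compact_closed (@norm_hausdorff _ _)) /closed_openC /open_measurable3.
by move=> /measurableC; rewrite setCK.
Qed.

Lemma heis_measure_compact_fin (C : set (R * R * R)) :
  compact C -> (heis_measure C < +oo)%E.
Proof.
move=> cC; have [M [_ hM]] := compact_bounded cC.
(* The norm bound holds for every number strictly above [M], hence the margin 1. *)
pose r := M + 1; pose I : set R := [set` `[- r, r]].
have CI : C `<=` (I `*` I) `*` I.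
  move=> [[x y] z] Cp; have Mr : M < r by rewrite ltrDl.
  have := hM r Mr _ Cp.
  rewrite /= /Num.norm /= !ge_max /I /= !in_itv /= -!ler_norml.
  by case/andP=> /andP[-> ->] ->.
have mI : measurable (I : set (measurableTypeR R)) by exact: measurable_itv.
have fI : (lebesgue_measure I < +oo)%E.
  by rewrite lebesgue_measure_itv; case: ifP => _; rewrite ?ltry // ltry.
apply: (@le_lt_trans _ _ (heis_measure ((I `*` I) `*` I))).
  apply: le_measure; rewrite ?inE //; first exact: compact_measurable3.
  by apply: measurableX => //; exact: measurableX.
have -> : heis_measure ((I `*` I) `*` I) =
    (lebesgue_measure I * lebesgue_measure I * lebesgue_measure I)%E.
  transitivity ((lebesgue_measure \x lebesgue_measure) (I `*` I) *
      lebesgue_measure I)%E.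
    by apply: product_measure1E => //; exact: measurableX.
  by congr (_ * _)%E; exact: product_measure1E.
have {}fI : (lebesgue_measure I : \bar R) \is a fin_num by rewrite ge0_fin_numE.
by rewrite -ge0_fin_numE ?mule_ge0 // !fin_numM.
Qed.

Lemma integrable_indic_compact (C : set (R * R * R)) (E : set T3) :
  compact C -> measurable E -> heis_measure.-integrable C (EFin \o \1_E).
Proof.
move=> cC mE; have mC := compact_measurable3 cC.
have hC : heis_measure.-integrable C (cst 1%E).
  apply/integrableP; split; first exact: measurable_cst.
  rewrite (eq_integral (cst 1%E)); last by move=> p _; rewrite /= normr1.
  by rewrite integral_cst // mul1e; exact: heis_measure_compact_fin.
apply: (le_integrable mC _ _ hC).
  apply/measurable_EFinP; apply: measurable_indic => //.
move=> p _ /=; rewrite lee_fin normr1 ger0_norm // indicE.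
Qed.

(** Dominated convergence on [C], with the constant 1 as dominating function, integrable because [C]
    has finite measure. The null set [N] absorbs the points where membership may fail to
    stabilise. *)
Lemma cvg_L1loc_indic (E_ : nat -> set T3) (E N : set T3) :
  (\forall n \near \oo, measurable (E_ n)) -> measurable E ->
  measurable N -> heis_measure N = 0%E ->
  (forall p, ~ N p -> \forall n \near \oo, E_ n p <-> E p) ->
  cvg_L1loc (fun n => \1_(E_ n)) (\1_E).
Proof.
move=> [n0 _ mE_] mE mN N0 hE C cC; have mC := compact_measurable3 cC.
have mEn n : measurable (E_ (n + n0)%N) by apply: mE_; exact: leq_addl.
(* The sets [E_ n] are known to be measurable only from [n0] on. *)
rewrite -(cvg_shiftn n0).
pose f n p := (`|\1_(E_ (n + n0)%N) p - \1_E p|%:E : \bar R).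
have mf n : measurable_fun C (f n).
  apply/measurable_EFinP; apply: measurableT_comp => //.
  apply: measurable_funB.
    by apply: measurable_indic; exact: mEn.
  by apply: measurable_indic; exact: mE.
have hC : heis_measure.-integrable C (cst 1%E).
  have := integrable_indic_compact cC (measurableT : measurable (setT : set T3)).
  by rewrite indicT.
have [] := @dominated_convergence _ _ _ heis_measure C mC f (cst 0%E) (cst 1%E)
  mf (measurable_cst _) _ hC _.
- exists N; split=> // p hp; apply: contrapT => Np; apply: hp => Cp.
  apply: cvg_near_cst; have [n1 _ hn1] := hE p Np.
  exists n1 => // n /= n1n; have := hn1 (n + n0)%N (leq_trans n1n (leq_addr _ _)).
  rewrite /f !indicE => EE; suff -> : (p \in E_ (n + n0)%N) = (p \in E).
    by rewrite subrr normr0.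
  by apply/idP/idP; rewrite !inE; tauto.
- apply: aeW => p n _; rewrite /f /= lee_fin normr_id !indicE.
  by do 2 case: (_ \in _); rewrite ?subrr ?subr0 ?sub0r ?normrN ?normr1 ?normr0.
by move=> _ _; rewrite integral0.
Qed.

Lemma heis_measure_null (N : set T3) :
  (forall xy, lebesgue_measure (xsection N xy) = 0%E) -> heis_measure N = 0%E.
Proof.
(* The product measure is by definition the integral of the measures of the sections. *)
move=> h; transitivity (\int[(lebesgue_measure \x lebesgue_measure)%E]_xy
    (lebesgue_measure (xsection N xy)))%E; first by [].
rewrite (eq_integral (cst 0%E)) ?integral0 // => xy _; exact: h.
Qed.

End HeisMeasure.

(** * The pair of half-parabolas attached to a single gap *)

Section GapFun.
Context {R : realType}.
Implicit Types m a b v u r : R.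

(* Writing v = m + (e - m) r with r >= 0 and e in {a, b}, the value at v is
   m + (e - m) r^2: for r <= 1 these are the points over x = 1 of the rays of
   slope e issued from the ray of slope m, and for (m, a, b) = (0, -alpha, alpha)
   and r >= 1 those of the rays issued from the negative x-axis. *)
Definition gapfun m a b v : R :=
  m + Num.max 0 (v - m) ^+ 2 / (b - m) - Num.max 0 (m - v) ^+ 2 / (m - a).

Lemma gapfun_right m a b r : m < b -> 0 <= r ->
  gapfun m a b (m + (b - m) * r) = m + (b - m) * r ^+ 2.
Proof.
move=> mb r0; have bm0 : 0 <= (b - m) * r by apply: mulr_ge0; lra.
rewrite /gapfun (max_r (x := 0)) ?(max_l (x := 0)); [|lra|lra].
rewrite expr0n /= mul0r subr0; field.
by rewrite subr_eq0 gt_eqF.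
Qed.

Lemma gapfun_left m a b r : a < m -> 0 <= r ->
  gapfun m a b (m + (a - m) * r) = m + (a - m) * r ^+ 2.
Proof.
move=> am r0; have am0 : 0 <= (m - a) * r by apply: mulr_ge0; lra.
rewrite /gapfun (max_l (x := 0)) ?(max_r (x := 0)); [|lra|lra].
rewrite expr0n /= mul0r addr0; field.
by rewrite subr_eq0 gt_eqF.
Qed.

Lemma gapfun_endr m a b : m < b -> gapfun m a b b = b.
Proof.
by move=> mb; have := @gapfun_right m a b 1 mb ler01; rewrite expr1n !mulr1 addrC subrK.
Qed.

Lemma gapfun_endl m a b : a < m -> gapfun m a b a = a.
Proof.
by move=> mb; have := @gapfun_left m a b 1 mb ler01; rewrite expr1n !mulr1 addrC subrK.
Qed.

Variant gap_arg_spec m a b v : Prop :=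
| GapRight r of 0 <= r & v = m + (b - m) * r
| GapLeft r of 0 <= r & v = m + (a - m) * r.

Lemma gap_argP m a b v : a < m < b -> gap_arg_spec m a b v.
Proof.
move=> /andP[am mb]; have [mv|/ltW vm] := leP m v.
  apply: (@GapRight _ _ _ _ ((v - m) / (b - m))).
    by apply: divr_ge0; lra.
  by field; rewrite subr_eq0 gt_eqF.
apply: (@GapLeft _ _ _ _ ((m - v) / (m - a))).
  by apply: divr_ge0; lra.
by field; rewrite subr_eq0 gt_eqF.
Qed.

Lemma le_gapfun m a b : a < m < b -> {homo gapfun m a b : v v' / v <= v'}.
Proof.
move=> /andP[am mb] v v' vv'; rewrite /gapfun.
have pos (w : R) : Num.max 0 w \is Num.nneg by rewrite nnegrE le_max lexx.
have homo (w w' : R) : w <= w' -> Num.max 0 w <= Num.max 0 w'.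
  by move=> ww'; rewrite ge_max !le_max lexx /= ww' orbT.
apply: lerB; first apply: lerD => //; rewrite ler_pM2r ?invr_gt0 ?subr_gt0 //.
  by rewrite ler_sqr //; apply: homo; lra.
by rewrite ler_sqr //; apply: homo; lra.
Qed.

(** In the parametrisation of [gap_argP] the function squares [r], so a preimage is found by taking
    a square root. *)
Lemma gapfun_surj m a b u : a < m < b -> exists v, gapfun m a b v = u.
Proof.
move=> /[dup] /andP[am mb] /(gap_argP u)[r r0 ->|r r0 ->].
  by exists (m + (b - m) * Num.sqrt r); rewrite gapfun_right ?sqrtr_ge0 // sqr_sqrtr.
by exists (m + (a - m) * Num.sqrt r); rewrite gapfun_left ?sqrtr_ge0 // sqr_sqrtr.
Qed.

(** With v = m + (e - m) r and 0 <= r <= 1, the displacement has size |e - m| r (1 - r). It is at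
    most |e - m| (1 - r), the distance to [e], and at most |e - m| r, the distance to [m], hence
    also the distance to the other end. *)
Lemma gapfun_dist m a b v : a < m < b -> a <= v <= b ->
  `|gapfun m a b v - v| <= v - a /\ `|gapfun m a b v - v| <= b - v.
Proof.
move=> /[dup] /andP[am mb] /(gap_argP v)[r r0 ->|r r0 ->] /andP[av vb].
  rewrite gapfun_right //.
  have r1 : r <= 1.
    rewrite -subr_ge0 -(pmulr_rge0 _ (_ : 0 < b - m)) ?subr_gt0 //; lra.
  have -> : m + (b - m) * r ^+ 2 - (m + (b - m) * r) = - ((b - m) * (r * (1 - r))).
    by ring.
  rewrite normrN ger0_norm; last by rewrite !mulr_ge0 //; lra.
  have : (b - m) * (r * (1 - r)) <= (b - m) * r.
    by rewrite ler_pM2l ?subr_gt0 //; rewrite ler_piMr //; lra.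
  have : (b - m) * (r * (1 - r)) <= (b - m) * (1 - r).
    by rewrite ler_pM2l ?subr_gt0 //; rewrite ler_piMl //; lra.
  by split; lra.
rewrite gapfun_left //.
have r1 : r <= 1.
  rewrite -subr_ge0 -(pmulr_rge0 _ (_ : 0 < m - a)) ?subr_gt0 //; lra.
have -> : m + (a - m) * r ^+ 2 - (m + (a - m) * r) = (m - a) * (r * (1 - r)).
  by ring.
rewrite ger0_norm; last by rewrite !mulr_ge0 //; lra.
have : (m - a) * (r * (1 - r)) <= (m - a) * r.
  by rewrite ler_pM2l ?subr_gt0 //; rewrite ler_piMr //; lra.
have : (m - a) * (r * (1 - r)) <= (m - a) * (1 - r).
  by rewrite ler_pM2l ?subr_gt0 //; rewrite ler_piMl //; lra.
by split; lra.
Qed.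

(** This homogeneity makes the two branches of [surface_height] agree outside the cone |y| < alpha
    x. *)
Lemma gapfun0_scale a b c v : 0 <= c ->
  gapfun 0 a b (c * v) = c ^+ 2 * gapfun 0 a b v.
Proof.
move=> c0; rewrite /gapfun !subr0 !sub0r !add0r -(mulrN c v).
have max_c (w : R) : Num.max 0 (c * w) = c * Num.max 0 w.
  by rewrite maxr_pMr // mulr0.
by rewrite !max_c !exprMn; ring.
Qed.

Lemma cvg_pos_part (u_ : R^nat) u :
  u_ @ \oo --> u -> Num.max 0 (u_ n) @[n --> \oo] --> Num.max 0 u.
Proof.
move=> cu; apply: (@continuous_cvg _ _ _ _ _ u_ (fun x : R => Num.max 0 x)) => //.
by apply: (@continuous_max _ _ (cst 0) id) => //; exact: cst_continuous.
Qed.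

Lemma cvg_gapfun (m_ a_ b_ : R^nat) m a b v : a < m < b ->
  m_ @ \oo --> m -> a_ @ \oo --> a -> b_ @ \oo --> b ->
  gapfun (m_ n) (a_ n) (b_ n) v @[n --> \oo] --> gapfun m a b v.
Proof.
move=> /andP[am mb] cm ca cb.
have cv : (fun _ : nat => v) @ \oo --> v by exact: cvg_cst.
apply: cvgB; first apply: cvgD => //; apply: cvgM.
- rewrite expr2; under eq_fun do rewrite expr2.
  have c : (fun n => Num.max 0 (v - m_ n)) @ \oo --> Num.max 0 (v - m).
    by apply: cvg_pos_part; exact: cvgB.
  exact: cvgM.
- by apply: cvgV; [rewrite subr_eq0 gt_eqF|exact: cvgB].
- rewrite expr2; under eq_fun do rewrite expr2.
  have c : (fun n => Num.max 0 (m_ n - v)) @ \oo --> Num.max 0 (m - v).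
    by apply: cvg_pos_part; exact: cvgB.
  exact: cvgM.
- by apply: cvgV; [rewrite subr_eq0 gt_eqF|exact: cvgB].
Qed.

End GapFun.

(** * The profile psi assembled from all the gaps *)

Section Profile.
Context {R : realType} {I : Type}.
Implicit Types (alpha v u k x y : R) (a m b : I -> R) (i : I).

(** The marks [m i] are arbitrary interior points because the tangent does not preserve midpoints:
    the gaps describing S_n are marked off centre in general. *)
Definition marked_gaps alpha a m b : Prop :=
  [/\ 0 < alpha, forall i, - alpha <= a i /\ b i <= alpha,
      forall i, a i < m i < b i &
      forall i j v, a i < v < b i -> a j < v < b j -> i = j].

Definition profile alpha a m b v : R :=
  if pselect (exists i, a i < v < b i) is left h then
    let i := projT1 (cid h) in gapfun (m i) (a i) (b i) v
  else if `|v| <= alpha then v else gapfun 0 (- alpha) alpha v.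

Variables (alpha : R) (a m b : I -> R).
Hypothesis gaps : marked_gaps alpha a m b.

Let alpha0 : 0 < alpha. Proof. by case: gaps. Qed.
Let bnd i : - alpha <= a i /\ b i <= alpha. Proof. by case: gaps. Qed.
Let amb i : a i < m i < b i. Proof. by case: gaps. Qed.
Let disj i j v : a i < v < b i -> a j < v < b j -> i = j.
Proof. by case: gaps => _ _ _; exact. Qed.
Let K := gap_complement alpha a b.
Let out := gapfun 0 (- alpha) alpha.

Let alphaN : - alpha < 0 < alpha. Proof. have a0 := alpha0; by apply/andP; split; lra. Qed.

Lemma gap_complementE k :
  K k <-> - alpha <= k <= alpha /\ (forall i, ~ a i < k < b i).
Proof.
rewrite /K /gap_complement; split=> -[/= kal kI].
  by split=> // i ki; apply: kI; exists i => //=; rewrite in_itv.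
by split=> /=; rewrite ?in_itv // => -[i _ /=]; rewrite in_itv /=; exact: kI.
Qed.

Lemma gap_complement_end : K alpha /\ K (- alpha).
Proof.
have al0 := alpha0.
split; apply/gap_complementE; split=> [|i]; first by apply/andP; split; lra.
- have [? ?] := bnd i => /andP[? ?]; lra.
- by apply/andP; split; lra.
- by have [? ?] := bnd i => /andP[? ?]; lra.
Qed.

(** If an end of gap [i] were inside gap [j], the two gaps would overlap; the midpoint of the
    overlap then forces [i = j], which is absurd since gaps are open. *)
Lemma gap_complement_gap_end i : K (a i) /\ K (b i).
Proof.
have [ai bi] := bnd i; have /andP[am mb] := amb i.
split; apply/gap_complementE; split=> [|j /andP[h1 h2]].
- by apply/andP; split; lra.
- have [ij|ij] := leP (b i) (b j).
    suff : i = j by move=> ?; subst j; lra.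
    by apply: (@disj _ _ ((a i + b i) / 2)); apply/andP; split; lra.
  suff : i = j by move=> ?; subst j; lra.
  by apply: (@disj _ _ ((a i + b j) / 2)); apply/andP; split; lra.
- by apply/andP; split; lra.
- have [ij|ij] := leP (a i) (a j).
    suff : i = j by move=> ?; subst j; lra.
    by apply: (@disj _ _ ((a j + b i) / 2)); apply/andP; split; lra.
  suff : i = j by move=> ?; subst j; lra.
  by apply: (@disj _ _ ((a i + b i) / 2)); apply/andP; split; lra.
Qed.

Variant profile_spec v : R -> Prop :=
| ProfileK of K v : profile_spec v v
| ProfileGap i of a i < v < b i : profile_spec v (gapfun (m i) (a i) (b i) v)
| ProfileOut of alpha < `|v| : profile_spec v (out v).

Lemma profileP v : profile_spec v (profile alpha a m b v).
Proof.
rewrite /profile; case: pselect => [h|h].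
  by apply: ProfileGap; exact: projT2 (cid h).
case: leP => [|?]; last exact: ProfileOut.
rewrite ler_norml => vK; apply: ProfileK; apply/gap_complementE; split=> // i vi.
by apply: h; exists i.
Qed.

Lemma gap_cases v : [\/ K v, exists i, a i < v < b i | alpha < `|v|].
Proof. by case: (profileP v) => [|i|]; [constructor 1|constructor 2; exists i|constructor 3]. Qed.

Lemma profile_fix k : K k -> profile alpha a m b k = k.
Proof.
move=> /gap_complementE[k1 k2]; case: profileP => // [i /k2//|].
by rewrite ltNge ler_norml k1.
Qed.

(** The closed gap is allowed since its ends lie in [K] and are fixed by [gapfun] as well. *)
Lemma profile_gap i v : a i <= v <= b i ->
  profile alpha a m b v = gapfun (m i) (a i) (b i) v.
Proof.
have al0 := alpha0.
have /andP[am mb] := amb i.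
have [Ka Kb] := gap_complement_gap_end i.
rewrite le_eqVlt => /andP[/predU1P[<- _|av]].
  by rewrite profile_fix // gapfun_endl.
rewrite le_eqVlt => /predU1P[->|vb]; first by rewrite profile_fix // gapfun_endr.
have vi : a i < v < b i by rewrite av.
case: profileP => [/gap_complementE[_ /(_ i)]//|j vj|]; first by rewrite (disj vi vj).
by have [? ?] := bnd i; rewrite ltNge ler_norml => /negP; case; apply/andP; split; lra.
Qed.

Lemma profile_out v : alpha <= `|v| -> profile alpha a m b v = out v.
Proof.
have al0 := alpha0.
move=> vout; case: profileP => // [/gap_complementE[]|i /andP[? ?]].
  rewrite -ler_norml => vin _.
  have /eqP : `|v| = alpha by apply/eqP; rewrite eq_le vin.
  rewrite eqr_norml => /andP[/orP[/eqP->|/eqP->] _].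
    by rewrite /out gapfun_endr.
  by rewrite /out gapfun_endl //; lra.
have [? ?] := bnd i; exfalso; move: vout; rewrite leNgt ltr_norml => /negP; apply.
by apply/andP; split; lra.
Qed.

(** A point of [K] lies in no gap, and the profile maps each gap and each outer half-line into
    itself, so no point crosses [k]. *)
Lemma profile_cmp k v : K k ->
  (v <= k -> profile alpha a m b v <= k) /\ (k <= v -> k <= profile alpha a m b v).
Proof.
have al0 := alpha0.
move=> /gap_complementE[/andP[k1 k2] kI]; case: profileP => // [i /andP[av vb]|vout].
  have /andP[am mb] := amb i; split=> h.
    rewrite (@le_trans _ _ (b i)) //.
      by rewrite -{2}(@gapfun_endr _ (m i) (a i) (b i)) // le_gapfun // ltW.
    by rewrite leNgt; apply/negP => kb; apply: (kI i); apply/andP; split; lra.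
  rewrite (@le_trans _ _ (a i)) //.
    by rewrite leNgt; apply/negP => kb; apply: (kI i); apply/andP; split; lra.
  by rewrite -{1}(@gapfun_endl _ (m i) (a i) (b i)) // le_gapfun // ltW.
move: vout; rewrite ltNge ler_norml negb_and -!ltNge => /orP vout; split=> h.
  have vNal : v <= - alpha by case: vout; lra.
  rewrite (@le_trans _ _ (- alpha)) // -{1}(@gapfun_endl _ 0 (- alpha) alpha); last lra.
  exact: le_gapfun.
have vNal : alpha <= v by case: vout; lra.
rewrite (@le_trans _ _ alpha) // -{1}(@gapfun_endr _ 0 (- alpha) alpha); last lra.
exact: le_gapfun.
Qed.

(** Either a point of [K] separates [v] from [v'] and [profile_cmp] applies on both sides, or both
    lie in one gap or beyond the same end, where [gapfun] is monotone. *)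
Lemma le_profile : {homo profile alpha a m b : v v' / v <= v'}.
Proof.
have al0 := alpha0.
move=> v v' vv'.
have through k : K k -> v <= k -> k <= v' ->
    profile alpha a m b v <= profile alpha a m b v'.
  by move=> Kk vk kv'; apply: (@le_trans _ _ k); apply profile_cmp.
have [Kal KNal] := gap_complement_end.
have [Kv|[i /andP[av vb]]|] := gap_cases v; first exact: (through v).
  have [bv'|v'b] := leP (b i) v'.
    by apply: (through (b i)) => //; [case: (gap_complement_gap_end i)|exact: ltW].
  by rewrite !(@profile_gap i) ?le_gapfun //; apply/andP; split; lra.
rewrite ltNge ler_norml negb_and -!ltNge => /orP[vN|valpha].
  have [v'N|v'N] := leP (- alpha) v'; first by apply: (through _ KNal) => //; exact: ltW.
  by rewrite !profile_out ?le_gapfun // ler_normr; apply/orP; right; lra.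
by rewrite !profile_out ?le_gapfun // ler_normr; apply/orP; left; lra.
Qed.

(** A preimage is sought in the piece containing [u]: [gapfun] is onto, and monotonicity with fixed
    ends keeps the preimage in that piece. *)
Lemma profile_surj u : exists v, profile alpha a m b v = u.
Proof.
have al0 := alpha0.
have [Ku|[i /andP[au ub]]|uout] := gap_cases u; first by exists u; exact: profile_fix.
  have /andP[am mb] := amb i; have [v vu] := gapfun_surj u (amb i).
  exists v; rewrite (@profile_gap i) //; apply/andP; split; apply/ltW; rewrite ltNge;
    apply/negP => /(le_gapfun (amb i)); rewrite vu ?gapfun_endl ?gapfun_endr //; lra.
have [v vu] := gapfun_surj u alphaN.
exists v; rewrite profile_out // leNgt; apply/negP; rewrite ltr_norml => /andP[/ltW v1 /ltW v2].
have := le_gapfun alphaN v1; have := le_gapfun alphaN v2.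
rewrite vu gapfun_endr // gapfun_endl; last lra.
by move=> h1 h2; move: uout; rewrite ltNge ler_norml h1 h2.
Qed.

(* On [K] the profile is the identity; this bound makes it almost the identity
   near [K], since a point of [K] may lie in a gap of its approximations. *)
Lemma profile_dist k v : K k ->
  `|profile alpha a m b v - v| <= (1 + `|v| / alpha) * `|v - k|.
Proof.
have al0 := alpha0.
move=> /gap_complementE[/andP[k1 k2] kI].
case: profileP => [_|i /[dup] iv /andP[/ltW av /ltW vb]|vout].
- by rewrite subrr normr0 mulr_ge0 // addr_ge0 // divr_ge0 // ltW.
(* Since [k] is outside the gap, one end of the gap lies between [v] and [k], and [gapfun_dist]
   bounds the displacement by the distance to that end. *)
- have avb : a i <= v <= b i by rewrite av.
  have [d1 d2] := gapfun_dist (amb i) avb.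
  apply: (@le_trans _ _ `|v - k|); last first.
    by rewrite ler_peMl // lerDl divr_ge0 // ltW.
  have [kv|vk] := leP v k.
    rewrite (ler0_norm (_ : v - k <= 0)) ?subr_le0 //; apply: (le_trans d2).
    suff : b i <= k by lra.
    by rewrite leNgt; apply/negP => kb; apply: (kI i); apply/andP; split; lra.
  rewrite (gtr0_norm (_ : 0 < v - k)) ?subr_gt0 //; apply: (le_trans d1).
  suff : k <= a i by lra.
  by rewrite leNgt; apply/negP => kb; apply: (kI i); apply/andP; split; lra.
(* Beyond the ends the displacement is |v| / alpha times the distance from [v] to the nearer end,
   which is at most |v - k|. *)
rewrite mulrDl mul1r -[leLHS]add0r lerD //.
move: vout; rewrite ltNge ler_norml negb_and -!ltNge => /orP[vN|valpha].
  have r0 : 0 <= - v / alpha by apply: divr_ge0; lra.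
  have -> : out v - v = - v / alpha * (v + alpha).
    rewrite {1}(_ : v = 0 + (- alpha - 0) * (- v / alpha)); last first.
      by field; rewrite gt_eqF.
    by rewrite /out gapfun_left //; [field; rewrite gt_eqF|lra].
  rewrite normrM normrM normrN normfV (gtr0_norm alpha0) ler_wpM2l //.
    by rewrite divr_ge0 // ltW.
  by rewrite !ltr0_norm; lra.
have r0 : 0 <= v / alpha by apply: divr_ge0; lra.
have -> : out v - v = v / alpha * (v - alpha).
  rewrite {1}(_ : v = 0 + (alpha - 0) * (v / alpha)); last first.
    by field; rewrite gt_eqF.
  by rewrite /out gapfun_right //; field; rewrite gt_eqF.
rewrite normrM normrM normfV (gtr0_norm alpha0) ler_wpM2l //.
  by rewrite divr_ge0 // ltW.
by rewrite !gtr0_norm; lra.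
Qed.

End Profile.

(** * Pointwise convergence of profiles *)

Section CvgProfile.
Context {R : realType} {I : Type}.

Lemma cvg_profile (alpha : R) (a m b : I -> R) (alpha_ : nat -> R)
    (a_ m_ b_ : nat -> I -> R) (v : R) :
  marked_gaps alpha a m b ->
  (\forall n \near \oo, marked_gaps (alpha_ n) (a_ n) (m_ n) (b_ n)) ->
  alpha_ @ \oo --> alpha ->
  (forall i, a_ n i @[n --> \oo] --> a i) ->
  (forall i, m_ n i @[n --> \oo] --> m i) ->
  (forall i, b_ n i @[n --> \oo] --> b i) ->
  (forall k, gap_complement alpha a b k -> exists2 k_ : nat -> R,
    \forall n \near \oo, gap_complement (alpha_ n) (a_ n) (b_ n) (k_ n) &
    k_ @ \oo --> k) ->
  profile (alpha_ n) (a_ n) (m_ n) (b_ n) v @[n --> \oo] --> profile alpha a m b v.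
Proof.
move=> gaps gaps_ calpha ca cm cb cK; have [alpha0 _ amb _] := gaps.
case: profileP => // [Kv|i /andP[av vb]|vout].
(* For [v] in [K], squeeze: the error bound of [profile_dist] at the approximants [k_ n] tends to
   0. *)
- have [k_ Kk_ ck_] := cK v Kv.
  have ce : (1 + `|v| / alpha_ n) * `|v - k_ n| @[n --> \oo] --> (0 : R).
    rewrite (_ : 0 = (1 + `|v| / alpha) * `|v - v|); last first.
      by rewrite subrr normr0 mulr0.
    apply: cvgM; last by apply: cvg_norm; apply: cvgB => //; exact: cvg_cst.
    apply: cvgD; first exact: cvg_cst.
    apply: cvgM; first exact: cvg_cst.
    by apply: cvgV => //; rewrite gt_eqF.
  apply: (@squeeze_cvgr _ _ _ _ (fun n => v - (1 + `|v| / alpha_ n) * `|v - k_ n|)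
      (fun n => v + (1 + `|v| / alpha_ n) * `|v - k_ n|)).
  + near=> n; rewrite -ler_distl; apply: profile_dist.
      by near: n.
    by near: n.
  + by rewrite -[X in _ --> X]subr0; apply: cvgB => //; exact: cvg_cst.
  + by rewrite -[X in _ --> X]addr0; apply: cvgD => //; exact: cvg_cst.
(* The strict inequalities placing [v] in gap [i] persist for large [n], so a single [gapfun] with
   converging parameters remains; likewise beyond the ends. *)
- apply: cvg_trans; last exact: cvg_gapfun v (amb i) (cm i) (ca i) (cb i).
  apply: near_eq_cvg; near=> n; rewrite (@profile_gap _ _ _ _ _ _ _ i) //.
    by near: n.
  by apply/andP; split; near: n; [exact: (cvgr_le _ (ca i))|exact: (cvgr_ge _ (cb i))].
have alphaN : - alpha < 0 < alpha by apply/andP; split; lra.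
have calphaN : (fun n => - alpha_ n) @ \oo --> - alpha by exact: cvgN.
have c0 : (fun _ : nat => 0 : R) @ \oo --> (0 : R) by exact: cvg_cst.
apply: cvg_trans; last exact: cvg_gapfun v alphaN c0 calphaN calpha.
apply: near_eq_cvg; near=> n; rewrite profile_out //; first by near: n.
by near: n; exact: (cvgr_le _ calpha).
Unshelve. all: by end_near. Qed.

End CvgProfile.

(** * The surface as a graph in the coordinates (x, y, u), and its epigraph *)

Section Surface.
Context {R : realType} {I : Type}.
Implicit Types (alpha v u k x y t e : R) (a m b : I -> R) (i : I).

(** The common form of [Lambda] and [Sn]: the marks [m] replace the midpoints. *)
Definition gap_surface alpha a m b : set (R * R * R) :=
  neg_x_axis
  `|` \bigcup_(k in gap_complement alpha a b) slope_ray horigin k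
  `|` \bigcup_i slope_ray horigin (m i)
  `|` \bigcup_(p in neg_x_axis) (slope_ray p alpha `|` slope_ray p (- alpha))
  `|` \bigcup_i \bigcup_(p in slope_ray horigin (m i))
        (slope_ray p (a i) `|` slope_ray p (b i)).

Definition surface_height alpha a m b x y : R :=
  if 0 < x then x ^+ 2 * profile alpha a m b (y / x)
  else gapfun 0 (- alpha) alpha y.

Variables (alpha : R) (a m b : I -> R).
Hypothesis gaps : marked_gaps alpha a m b.

Let alpha0 : 0 < alpha. Proof. by case: gaps. Qed.
Let amb i : a i < m i < b i. Proof. by case: gaps. Qed.
Let H := surface_height alpha a m b.
Let alphaN : - alpha < 0 < alpha.
Proof. by have ? := alpha0; apply/andP; split; lra. Qed.

Lemma surface_height_out x y : alpha * x <= `|y| ->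
  H x y = gapfun 0 (- alpha) alpha y.
Proof.
move=> xy; rewrite /H /surface_height; case: ifP => // x0.
rewrite profile_out //; last by rewrite normrM normfV (gtr0_norm x0) ler_pdivlMr.
rewrite -gapfun0_scale; last exact: ltW.
by rewrite mulrC divfK // gt_eqF.
Qed.

Lemma surface_height0 : H 0 0 = 0.
Proof.
rewrite surface_height_out ?mulr0 ?normr0 // /gapfun.
by rewrite subrr maxxx expr0n /= !mul0r addr0 subr0.
Qed.

Lemma surface_height_neg_ray x t : x <= 0 -> 0 <= t ->
  H (x + t) (alpha * t) = alpha * t ^+ 2 /\
  H (x + t) (- alpha * t) = - alpha * t ^+ 2.
Proof.
move=> x0 t0; have al0 := alpha0.
have h : alpha * (x + t) <= `|alpha * t|.
  by rewrite ger0_norm ?mulr_ge0 ?(ltW al0) // ler_pM2l //; lra.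
rewrite !surface_height_out //; last by rewrite mulNr normrN.
split.
  by have := gapfun_right (- alpha) alpha0 t0; rewrite !add0r !subr0.
have := @gapfun_left _ 0 (- alpha) alpha t.
by rewrite !add0r !subr0; apply => //; lra.
Qed.

Lemma surface_height_K x k : 0 <= x -> gap_complement alpha a b k ->
  H x (k * x) = k * x ^+ 2.
Proof.
rewrite le_eqVlt => /predU1P[<- _|x0 Kk].
  by rewrite mulr0 surface_height0 expr0n mulr0.
by rewrite /H /surface_height x0 mulfK ?gt_eqF // profile_fix // mulrC.
Qed.

(** On a ray of slope e issued from the point of the marked ray over [x], the quotient y / (x + t)
    is m + (e - m) r with r = t / (x + t) in [0, 1], and [gapfun] squares [r]. *)
Lemma surface_height_gap_ray i x t : 0 <= x -> 0 <= t ->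
  H (x + t) (m i * x + a i * t) = m i * x ^+ 2 + 2 * m i * x * t + a i * t ^+ 2 /\
  H (x + t) (m i * x + b i * t) = m i * x ^+ 2 + 2 * m i * x * t + b i * t ^+ 2.
Proof.
move=> x0 t0; have /andP[am mb] := amb i.
(* The origin is treated apart, as it falls in the other branch of [surface_height]. *)
have [xt0|xt] := leP (x + t) 0.
  have [-> ->] : x = 0 /\ t = 0 by split; lra.
  by rewrite !mulr0 !addr0 expr0n !mulr0 !addr0 surface_height0.
have r0 : 0 <= t / (x + t) by apply: divr_ge0; lra.
have r1 : t / (x + t) <= 1 by rewrite ler_pdivrMr // mul1r; lra.
have nz : x + t != 0 by rewrite gt_eqF.
have aib : a i <= m i <= b i by rewrite !ltW.
rewrite /H /surface_height xt; split.
  rewrite (_ : _ / _ = m i + (a i - m i) * (t / (x + t))); last by field.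
  have h0 : 0 <= (m i - a i) * (t / (x + t)) by apply: mulr_ge0 => //; lra.
  have h1 : (m i - a i) * (t / (x + t)) <= m i - a i by rewrite ler_piMr //; lra.
  rewrite (@profile_gap _ _ _ _ _ _ _ i) //; last by apply/andP; split; lra.
  by rewrite gapfun_left //; field.
rewrite (_ : _ / _ = m i + (b i - m i) * (t / (x + t))); last by field.
have h0 : 0 <= (b i - m i) * (t / (x + t)) by apply: mulr_ge0 => //; lra.
have h1 : (b i - m i) * (t / (x + t)) <= b i - m i by rewrite ler_piMr //; lra.
rewrite (@profile_gap _ _ _ _ _ _ _ i) //; last by apply/andP; split; lra.
by rewrite gapfun_right //; field.
Qed.

Lemma surface_height_mid i x : 0 <= x -> H x (m i * x) = m i * x ^+ 2.
Proof.
by move=> x0; have [] := surface_height_gap_ray i x0 (lexx 0); rewrite !(mulr0, expr0n, addr0).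
Qed.

Lemma slope_rayP (p q : R * R * R) e : slope_ray p e q <->
  [/\ p.1.1 <= q.1.1, q.1.2 = p.1.2 + e * (q.1.1 - p.1.1) &
      q.2 = p.2 + (p.1.1 * e - p.1.2) * (q.1.1 - p.1.1) / 2].
Proof.
case: p q => [[x y] z] [[x' y'] z']; split; rewrite /slope_ray /hmul /=.
  move=> [t] /=; rewrite in_itv /= andbT => t0 [<- <- <-].
  by rewrite lerDl; split => //; ring.
move=> [xx' -> ->]; exists (x' - x); first by rewrite /= in_itv /= andbT subr_ge0.
by congr (_, _, _); field.
Qed.

Lemma slope_ray_originP (q : R * R * R) e : slope_ray horigin e q <->
  [/\ 0 <= q.1.1, q.1.2 = e * q.1.1 & q.2 = 0].
Proof.
rewrite slope_rayP /= subr0 add0r; split=> -[? ? h]; split=> //.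
  by rewrite h; ring.
by rewrite h; ring.
Qed.

Lemma neg_x_axisP (q : R * R * R) : neg_x_axis q <->
  [/\ q.1.1 <= 0, q.1.2 = 0 & q.2 = 0].
Proof.
case: q => [[x y] z]; split=> /=.
  by move=> [t /=]; rewrite in_itv /= => t0 [<- <- <-].
by move=> [x0 -> ->]; exists x; rewrite //= in_itv.
Qed.

Lemma gap_surfaceE (p : R * R * R) :
  gap_surface alpha a m b p <-> H p.1.1 p.1.2 = p.1.1 * p.1.2 - 2 * p.2.
Proof.
have al0 := alpha0.
case: p => [[x y] z] /=; split.
  move=> [[[[/neg_x_axisP[/= x0 -> ->]|[k Kk /slope_ray_originP[/= x0 -> ->]]]|
    [i _ /slope_ray_originP[/= x0 -> ->]]]|
    [[[x1 y1] z1] /neg_x_axisP[/= x0 -> ->] q]]|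
    [i _ [[[x1 y1] z1] /slope_ray_originP[/= x0 -> ->] q]]].
  - have [h _] := surface_height_neg_ray x0 (lexx 0).
    by move: h; rewrite addr0 !mulr0 expr0n /= mulr0 subr0.
  - by rewrite surface_height_K //; ring.
  - by rewrite surface_height_mid //; ring.
  - case: q => /slope_rayP[/= xx -> ->].
      have [h _] := @surface_height_neg_ray x1 (x - x1) x0 (ltac:(lra)).
      by move: h; rewrite addrC subrK add0r => ->; field.
    have [_ h] := @surface_height_neg_ray x1 (x - x1) x0 (ltac:(lra)).
    by move: h; rewrite addrC subrK add0r => ->; field.
  - have xE : x1 + (x - x1) = x by ring.
    case: q => /slope_rayP[/= xx -> ->].
      have [h _] := @surface_height_gap_ray i x1 (x - x1) x0 (ltac:(lra)).
      by move: h; rewrite xE => ->; field.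
    have [_ h] := @surface_height_gap_ray i x1 (x - x1) x0 (ltac:(lra)).
    by move: h; rewrite xE => ->; field.
(* Conversely, the height determines [z], so it suffices to find a ray of the surface passing over
   (x, y); its [z] then agrees by the height computed along that ray. *)
move=> hz; have {hz} -> : z = (x * y - H x y) / 2 by rewrite hz; field.
(* Going back from (x, y) with slope alpha or -alpha for the time |y| / alpha reaches the negative
   x-axis. *)
have outer : alpha * x <= `|y| -> gap_surface alpha a m b (x, y, (x * y - H x y) / 2).
  move=> xy; left; right; have [y0|/ltW y0] := leP 0 y.
    rewrite ger0_norm // in xy.
    have yx : x <= y / alpha by rewrite ler_pdivlMr // mulrC.
    have ya0 : 0 <= y / alpha by rewrite divr_ge0 // ltW.
    exists (x - y / alpha, 0, 0); first by apply/neg_x_axisP; split=> //=; lra.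
    left; apply/slope_rayP; split=> /=; [lra|by field; rewrite gt_eqF|].
    have [h _] := @surface_height_neg_ray (x - y / alpha) (y / alpha) (ltac:(lra)) ya0.
    move: h; rewrite subrK (_ : alpha * (y / alpha) = y); last by field; rewrite gt_eqF.
    by move=> ->; field; rewrite gt_eqF.
  rewrite ler0_norm // in xy.
  have yx : x <= - y / alpha by rewrite ler_pdivlMr // mulrC.
  have ya0 : 0 <= - y / alpha by rewrite divr_ge0 ?oppr_ge0 // ltW.
  exists (x - - y / alpha, 0, 0); first by apply/neg_x_axisP; split=> //=; lra.
  right; apply/slope_rayP; split=> /=; [lra|by field; rewrite gt_eqF|].
  have [_ h] := @surface_height_neg_ray (x - - y / alpha) (- y / alpha) (ltac:(lra)) ya0.
  move: h; rewrite subrK (_ : - alpha * (- y / alpha) = y); last by field; rewrite gt_eqF.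
  by move=> ->; field; rewrite gt_eqF.
have [x0|x0] := leP x 0.
  by apply: outer; apply: (@le_trans _ _ 0) => //; rewrite pmulr_rle0.
have nz : x != 0 by rewrite gt_eqF.
have [Kv|[i /andP[av vb]]|vout] := gap_cases alpha a m b (y / x).
- left; left; left; right; exists (y / x) => //; apply/slope_ray_originP; split=> /=.
  + exact: ltW.
  + by rewrite divfK.
  + have := surface_height_K (ltW x0) Kv; rewrite divfK // => ->.
    by field.
- right; exists i => //.
  have /andP[am mb] := amb i; rewrite ltr_pdivlMr // in av; rewrite ltr_pdivrMr // in vb.
  have [my|ym] := leP (m i * x) y.
    (* The time [t] solves m (x - t) + b t = y; being in the gap gives [t <= x], so the source lies
       on the marked ray. *)
    pose t := (y - m i * x) / (b i - m i).
    have t0 : 0 <= t by apply: divr_ge0; lra.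
    have tx : 0 <= x - t.
      by rewrite subr_ge0 ler_pdivrMr ?subr_gt0 //; lra.
    exists (x - t, m i * (x - t), 0); first exact/slope_ray_originP.
    right; apply/slope_rayP; split=> /=; [lra| |].
      by rewrite /t; field; rewrite subr_eq0 gt_eqF.
    have [_ h] := surface_height_gap_ray i tx t0; move: h; rewrite subrK.
    have -> : m i * (x - t) + b i * t = y.
      by rewrite /t; field; rewrite subr_eq0 gt_eqF.
    by move=> ->; rewrite /t; field; rewrite subr_eq0 gt_eqF.
  pose t := (m i * x - y) / (m i - a i).
  have t0 : 0 <= t by apply: divr_ge0; lra.
  have tx : 0 <= x - t.
    by rewrite subr_ge0 ler_pdivrMr ?subr_gt0 //; lra.
  exists (x - t, m i * (x - t), 0); first exact/slope_ray_originP.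
  left; apply/slope_rayP; split=> /=; [lra| |].
    by rewrite /t; field; rewrite subr_eq0 gt_eqF.
  have [h _] := surface_height_gap_ray i tx t0; move: h; rewrite subrK.
  have -> : m i * (x - t) + a i * t = y.
    by rewrite /t; field; rewrite subr_eq0 gt_eqF.
  by move=> ->; rewrite /t; field; rewrite subr_eq0 gt_eqF.
apply: outer; move: vout; rewrite normrM normfV (gtr0_norm x0) ltr_pdivlMr //.
exact: ltW.
Qed.

Lemma le_surface_height x : {homo H x : y y' / y <= y'}.
Proof.
move=> y y' yy'; rewrite /H /surface_height; case: ifP => x0.
  rewrite ler_pM2l ?exprn_gt0 //; apply: le_profile => //.
  by rewrite ler_pM2r ?invr_gt0.
exact: le_gapfun.
Qed.

Lemma surface_height_surj x u : exists y, H x y = u.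
Proof.
have [x0|x0] := ltP 0 x; last first.
  have [y yu] := gapfun_surj u alphaN.
  by exists y; rewrite /H /surface_height ltNge x0.
have [v vu] := profile_surj gaps (u / x ^+ 2).
have nz : x != 0 by rewrite gt_eqF.
by exists (v * x); rewrite /H /surface_height x0 mulfK // vu mulrC divfK // expf_neq0.
Qed.

(** Right multiplication by [Ypow t] keeps x and u = x y - 2 z and raises y, so monotonicity of [H]
    in y gives one inclusion and surjectivity supplies the base point for the other. *)
Lemma epigraph_gap_surfaceE : epigraph (gap_surface alpha a m b) =
  [set p | p.1.1 * p.1.2 - 2 * p.2 <= H p.1.1 p.1.2].
Proof.
apply/seteqP; split=> [p [[[x y] z] Sp [t t0 <-]]|[[x y] z] /= xyz].
  move: t0; rewrite /= in_itv /= andbT => t0; move/gap_surfaceE: Sp => /= h.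
  have : H x y <= H x (y + t) by apply: le_surface_height; lra.
  by rewrite h addr0; lra.
have [y0 y0E] := surface_height_surj x (x * y - 2 * z).
have [y0y|yy0] := leP y0 y.
  exists (x, y0, z - x * (y - y0) / 2).
    by apply/gap_surfaceE => /=; rewrite y0E; field.
  exists (y - y0); first by rewrite /= in_itv /= andbT subr_ge0.
  by rewrite /hmul /=; congr (_, _, _); field.
(* If the base point found is above [y], monotonicity squeezes [H x y] to u, so the point itself is
   on the surface. *)
exists (x, y, z); last first.
  exists 0; first by rewrite /= in_itv /= lexx.
  by rewrite /hmul /=; congr (_, _, _); field.
apply/gap_surfaceE => /=; apply/eqP; rewrite eq_le xyz andbT -y0E.
by apply: le_surface_height; exact: ltW.
Qed.

End Surface.

(** * Measurability of the epigraph and nullity of its boundary *)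

Section MeasurableSurface.
Context {R : realType} {I : Type}.
Notation T3 := (measurableTypeR R * measurableTypeR R * measurableTypeR R)%type.
Variables (alpha : R) (a m b : I -> R).
Hypothesis gaps : marked_gaps alpha a m b.

(** The height is built from coordinates, [profile] and [gapfun], and the last two are measurable
    because they are monotone. *)
Lemma measurable_surface_height :
  measurable_fun [set: T3] (fun p : T3 => surface_height alpha a m b p.1.1 p.1.2).
Proof.
have alphaN : - alpha < 0 < alpha by have [? _ _ _] := gaps; apply/andP; split; lra.
have m1 : measurable_fun [set: T3] (fun p : T3 => p.1.1).
  exact: (measurableT_comp measurable_fst measurable_fst).
have m2 : measurable_fun [set: T3] (fun p : T3 => p.1.2).
  exact: (measurableT_comp measurable_snd measurable_fst).
(* On the branch [0 < x] the inverse is a real power, which is measurable on the whole line. *)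
have -> : (fun p : T3 => surface_height alpha a m b p.1.1 p.1.2) =
    (fun p : T3 => if 0 < p.1.1 then
       p.1.1 ^+ 2 * profile alpha a m b (p.1.2 * p.1.1 `^ (-1))
     else gapfun 0 (- alpha) alpha p.1.2).
  apply/funext => p; rewrite /surface_height; case: ifP => // p0.
  by rewrite powR_inv1 // ltW.
apply: measurable_fun_ifT.
- apply: measurable_fun_ltr => //; exact: measurable_cst.
- apply: measurable_funM; first exact: measurable_funX.
  apply: (@measurableT_comp _ _ _ _ _ _ (profile alpha a m b)).
    apply: nondecreasing_measurable => //; exact: le_profile.
  apply: measurable_funM => //.
  by apply: (@measurableT_comp _ _ _ _ _ _ (fun x : R => x `^ (-1))).
- apply: (@measurableT_comp _ _ _ _ _ _ (gapfun 0 (- alpha) alpha)) => //.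
  by apply: nondecreasing_measurable => //; exact: le_gapfun.
Qed.

Let measurable_coset_coord :
  measurable_fun [set: T3] (fun p : T3 => p.1.1 * p.1.2 - 2 * p.2 : R).
Proof.
apply: measurable_funB; apply: measurable_funM.
- exact: (measurableT_comp measurable_fst measurable_fst).
- exact: (measurableT_comp measurable_snd measurable_fst).
- exact: measurable_cst.
- exact: measurable_snd.
Qed.

Lemma measurable_epigraph_gap_surface :
  measurable (epigraph (gap_surface alpha a m b) : set T3).
Proof.
rewrite epigraph_gap_surfaceE //.
have := measurable_fun_ler measurable_coset_coord measurable_surface_height.
move=> /(_ measurableT [set true]); rewrite setTI; exact.
Qed.

Definition gap_graph : set (R * R * R) :=
  [set p | p.1.1 * p.1.2 - 2 * p.2 = surface_height alpha a m b p.1.1 p.1.2].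

Lemma measurable_gap_graph : measurable (gap_graph : set T3).
Proof.
have := measurable_fun_eqr measurable_coset_coord measurable_surface_height.
move=> /(_ measurableT [set true]); rewrite setTI => mG.
rewrite (_ : gap_graph = [set p | p.1.1 * p.1.2 - 2 * p.2 ==
    surface_height alpha a m b p.1.1 p.1.2]); first exact: mG.
by apply/seteqP; split=> p /= /eqP.
Qed.

Lemma heis_measure_gap_graph : heis_measure gap_graph = 0%E.
Proof.
apply: heis_measure_null => -[x y]; rewrite (_ : xsection _ _ =
    [set (x * y - surface_height alpha a m b x y) / 2]).
  exact: lebesgue_measure_set1.
apply/seteqP; split=> z /=; rewrite /xsection /= inE /gap_graph /= => h.
  by rewrite -h; field.
by rewrite h; field.
Qed.

End MeasurableSurface.

(** * Local L1 convergence of epigraphs from convergence of the slopes *)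

Section CvgSurface.
Context {R : realType} {I : Type}.
Notation T3 := (measurableTypeR R * measurableTypeR R * measurableTypeR R)%type.

Lemma cvg_L1loc_gap_surface (alpha : R) (a m b : I -> R) (alpha_ : nat -> R)
    (a_ m_ b_ : nat -> I -> R) (S_ : nat -> set (R * R * R)) :
  marked_gaps alpha a m b ->
  (\forall n \near \oo, marked_gaps (alpha_ n) (a_ n) (m_ n) (b_ n)) ->
  alpha_ @ \oo --> alpha ->
  (forall i, a_ n i @[n --> \oo] --> a i) ->
  (forall i, m_ n i @[n --> \oo] --> m i) ->
  (forall i, b_ n i @[n --> \oo] --> b i) ->
  (forall k, gap_complement alpha a b k -> exists2 k_ : nat -> R,
    \forall n \near \oo, gap_complement (alpha_ n) (a_ n) (b_ n) (k_ n) &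
    k_ @ \oo --> k) ->
  (\forall n \near \oo, S_ n = gap_surface (alpha_ n) (a_ n) (m_ n) (b_ n)) ->
  cvg_L1loc (fun n => \1_(epigraph (S_ n)))
    (\1_(epigraph (gap_surface alpha a m b))).
Proof.
move=> gaps gaps_ calpha ca cm cb cK SE; have [alpha0 _ _ _] := gaps.
have alphaN : - alpha < 0 < alpha by apply/andP; split; lra.
have calphaN : (fun n => - alpha_ n) @ \oo --> - alpha by exact: cvgN.
have c0 : (fun _ : nat => 0 : R) @ \oo --> (0 : R) by exact: cvg_cst.
have cH x y : surface_height (alpha_ n) (a_ n) (m_ n) (b_ n) x y @[n --> \oo] -->
    surface_height alpha a m b x y.
  rewrite /surface_height; case: ifP => _; last exact: cvg_gapfun.
  by apply: cvgM; [exact: cvg_cst|exact: cvg_profile].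
apply: (@cvg_L1loc_indic _ _ _ (gap_graph alpha a m b)).
- by near=> n; rewrite (near SE n) //; apply: measurable_epigraph_gap_surface; near: n.
- exact: measurable_epigraph_gap_surface.
- exact: measurable_gap_graph.
- exact: heis_measure_gap_graph.
(* Off the limit graph the comparison of u with the height is strict, hence it survives for large
   [n]. *)
move=> p /eqP; rewrite neq_lt => /orP[pH|Hp]; near=> n;
  rewrite (near SE n) // !epigraph_gap_surfaceE //=; try by near: n.
  split=> _; first exact: ltW.
  by near: n; exact: (cvgr_ge _ (cH _ _)).
split; rewrite leNgt => /negP; [|by rewrite Hp].
by case; near: n; exact: (cvgr_lt _ (cH _ _)).
Unshelve. all: by end_near. Qed.

End CvgSurface.

(** * The stretched surfaces as gap surfaces with slopes n^2 tan (k / n^2) *)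

Section Stretch.
Context {R : realType}.
Implicit Types (alpha k v theta : R) (n : nat).

(* The slope of the image under [stretch n^-1 n] of a ray of angle k / n^2. *)
Definition scaled_tan n k : R := n%:R ^+ 2 * tan (k / n%:R ^+ 2).

Definition scaled_atan n v : R := n%:R ^+ 2 * atan (v / n%:R ^+ 2).

(** The stretch is an automorphism sending the direction (cos theta, sin theta) to (cos theta / n, n
    sin theta); as cos theta > 0, time is only rescaled by a positive factor. *)
Lemma stretch_angle_ray n (p : R * R * R) theta : (0 < n)%N -> 0 < cos theta ->
  stretch n%:R^-1 n%:R @` angle_ray p theta =
  slope_ray (stretch n%:R^-1 n%:R p) (n%:R ^+ 2 * tan theta).
Proof.
move=> n0 c0; have N0 : n%:R != 0 :> R by rewrite pnatr_eq0 -lt0n.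
have cN0 : cos theta != 0 by rewrite gt_eqF.
rewrite /angle_ray /slope_ray image_comp; apply/seteqP; split=> q [t] /=;
  rewrite in_itv /= andbT => t0 <-.
  exists (t * cos theta / n%:R).
    by rewrite /= in_itv /= andbT divr_ge0 // mulr_ge0 // ltW.
  by rewrite /stretch /hmul /tan /=; congr (_, _, _); field; rewrite ?N0 ?cN0.
exists (t * n%:R / cos theta).
  by rewrite /= in_itv /= andbT divr_ge0 ?(ltW c0) // mulr_ge0.
by rewrite /stretch /hmul /tan /=; congr (_, _, _); field; rewrite ?N0 ?cN0.
Qed.

Lemma stretch_angle_ray_pi n : (0 < n)%N ->
  stretch n%:R^-1 n%:R @` angle_ray horigin pi = neg_x_axis :> set (R * R * R).
Proof.
move=> n0; have N0 : n%:R != 0 :> R by rewrite pnatr_eq0 -lt0n.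
rewrite /angle_ray /neg_x_axis image_comp; apply/seteqP; split=> q [t] /=;
  rewrite in_itv /= ?andbT => t0 <-.
  exists (- t / n%:R).
    by rewrite /= in_itv /= mulNr oppr_le0 divr_ge0.
  by rewrite /stretch /hmul /= cospi sinpi; congr (_, _, _); field; rewrite ?N0.
exists (- t * n%:R).
  by rewrite /= in_itv /= andbT mulr_ge0 // oppr_ge0.
by rewrite /stretch /hmul /= cospi sinpi; congr (_, _, _); field; rewrite ?N0.
Qed.

Lemma stretch_horigin (c d : R) : stretch c d horigin = horigin.
Proof. by rewrite /stretch /horigin /= !mulr0. Qed.

Lemma angle_ray_2pi (p : R * R * R) theta :
  angle_ray p (2 * pi - theta) = angle_ray p (- theta).
Proof.
have -> : 2 * pi - theta = - theta + pi *+ 2 by rewrite -mulr_natl; ring.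
by rewrite /angle_ray cosD2pi sinD2pi.
Qed.

(** This is tan'(0) = 1, read along the increments k / n^2. *)
Lemma cvg_scaled_tan k : scaled_tan n k @[n --> \oo] --> k.
Proof.
(* The difference quotient only takes nonzero increments. *)
have [->|k0] := eqVneq k 0.
  rewrite /scaled_tan; under eq_fun do rewrite mul0r tan0 mulr0.
  exact: cvg_cst.
pose h n : R := k / n%:R ^+ 2.
have h0 : h @ \oo --> 0^'.
  have cV : (fun n => (n%:R : R)^-1) @ \oo --> (0 : R).
    apply/gtr0_cvgV0; last exact: cvgr_idn.
    by near=> n; rewrite ltr0n; near: n; exact: nbhs_infty_gt.
  have ch : h @ \oo --> (0 : R).
    rewrite -(mulr0 k) -(mulr0 0) /h; under eq_fun do rewrite expr2 invfM.
    by apply: cvgM; [exact: cvg_cst|exact: cvgM].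
  move=> P /ch hP; change (\forall n \near \oo, P (h n)); near=> n.
  have : h n != 0.
    by rewrite mulf_neq0 // invr_neq0 // expf_neq0 // pnatr_eq0 -lt0n; near: n;
      exact: nbhs_infty_gt.
  by near: n; exact: hP.
have [dt dE] := @is_derive_tan R 0 (ltac:(by rewrite cos0 oner_eq0)).
move: dt dE; rewrite /derivable /derive cos0 expr1n invr1 => dt dE.
rewrite dE in dt.
have := cvg_comp _ _ h0 dt.
move=> /(cvgM (cvg_cst k)); rewrite mulr1 => ct.
apply: cvg_trans ct; apply: near_eq_cvg; near=> n.
have N0 : n%:R != 0 :> R.
  by rewrite pnatr_eq0 -lt0n; near: n; exact: nbhs_infty_gt.
rewrite /= tan0 subr0 addr0 /h /scaled_tan /GRing.scale /= mulr1.
by field; rewrite N0.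
Unshelve. all: by end_near. Qed.

Section Scaled.
Variables (alpha : R) (n : nat).
Hypotheses (alpha0 : 0 < alpha) (alpha_n : Num.sqrt alpha < n%:R).

Let n0 : (0 < n)%N.
Proof. by rewrite -(@ltr0n R); apply: le_lt_trans alpha_n; exact: sqrtr_ge0. Qed.

Let N0 : 0 < n%:R ^+ 2 :> R.
Proof. by rewrite exprn_gt0 // ltr0n. Qed.

Let alphaN : alpha / n%:R ^+ 2 < 1.
Proof.
rewrite ltr_pdivrMr // mul1r -[ltLHS](sqr_sqrtr (ltW alpha0)).
by rewrite ltr_pXn2r // nnegrE ?sqrtr_ge0.
Qed.

(** The condition on [n] gives alpha / n^2 < 1 <= pi / 2, so all angles stay in the main branch of
    the tangent. *)
Lemma scaled_angle k : - alpha <= k <= alpha ->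
  k / n%:R ^+ 2 \in `]- (pi / 2), pi / 2[.
Proof.
move=> /andP[k1 k2]; have pi2 := @pi_ge2 R; have aN := alphaN.
have : k / n%:R ^+ 2 <= alpha / n%:R ^+ 2 by rewrite ler_pM2r ?invr_gt0.
have : - (alpha / n%:R ^+ 2) <= k / n%:R ^+ 2 by rewrite -mulNr ler_pM2r ?invr_gt0.
by rewrite in_itv /= => ? ?; apply/andP; split; lra.
Qed.

Lemma cos_scaled_angle k : - alpha <= k <= alpha -> 0 < cos (k / n%:R ^+ 2).
Proof.
move=> /scaled_angle; rewrite in_itv /= => h.
exact: cos_gt0_pihalf.
Qed.

Lemma scaled_tanK k : - alpha <= k <= alpha -> scaled_atan n (scaled_tan n k) = k.
Proof.
move=> /scaled_angle kN; rewrite /scaled_atan /scaled_tan.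
by rewrite [X in atan X]mulrC mulKf ?gt_eqF // tanK // mulrC divfK // gt_eqF.
Qed.

Lemma scaled_atanK v : scaled_tan n (scaled_atan n v) = v.
Proof.
rewrite /scaled_atan /scaled_tan.
by rewrite [X in tan X]mulrC mulKf ?gt_eqF // atanK mulrC divfK // gt_eqF.
Qed.

(** The tangent increases only on a branch, whereas [scaled_atan] increases on the whole line; order
    comparisons of slopes are therefore moved through it. *)
Lemma lt_scaled_atan v v' : (scaled_atan n v < scaled_atan n v') = (v < v').
Proof.
have h : {homo scaled_atan n : v v' / v < v'}.
  by move=> x y xy; rewrite ltr_pM2l // lt_atan // ltr_pM2r ?invr_gt0.
exact: (leW_mono (le_mono h)).
Qed.

Lemma scaled_tanN k : scaled_tan n (- k) = - scaled_tan n k.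
Proof. by rewrite /scaled_tan mulNr tanN mulrN. Qed.

Lemma lt_scaled_tanl k v : - alpha <= k <= alpha ->
  (scaled_tan n k < v) = (k < scaled_atan n v).
Proof. by move=> kal; rewrite -lt_scaled_atan scaled_tanK. Qed.

Lemma lt_scaled_tanr k v : - alpha <= k <= alpha ->
  (v < scaled_tan n k) = (scaled_atan n v < k).
Proof. by move=> kal; rewrite -lt_scaled_atan scaled_tanK. Qed.

Variables (I : Type) (a m b : I -> R).
Hypothesis gaps : marked_gaps alpha a m b.

Let bnd_alpha : - alpha <= alpha <= alpha.
Proof. by have ? := alpha0; apply/andP; split; lra. Qed.

Let bnd_alphaN : - alpha <= - alpha <= alpha.
Proof. by have ? := alpha0; apply/andP; split; lra. Qed.

Let bnd_gap i : [/\ - alpha <= a i <= alpha, - alpha <= m i <= alpha &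
  - alpha <= b i <= alpha].
Proof.
have [_ /(_ i)[? ?] /(_ i)/andP[? ?] _] := gaps.
by split; apply/andP; split; lra.
Qed.

Lemma marked_gaps_scaled : marked_gaps (scaled_tan n alpha) (scaled_tan n \o a)
  (scaled_tan n \o m) (scaled_tan n \o b).
Proof.
have [_ ab amb disj] := gaps.
split=> [|i|i|i j v] /=.
- by rewrite lt_scaled_tanr // /scaled_atan mul0r atan0 mulr0.
- have [ai mi bi] := bnd_gap i; rewrite -scaled_tanN !leNgt !lt_scaled_tanl //.
  by rewrite !scaled_tanK // -!leNgt; exact: ab.
- have [ai mi bi] := bnd_gap i.
  by rewrite !lt_scaled_tanl // !scaled_tanK.
have [ai _ bi] := bnd_gap i; have [aj _ bj] := bnd_gap j.
rewrite !lt_scaled_tanl // !lt_scaled_tanr //; exact: disj.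
Qed.

Lemma gap_complement_scaled :
  gap_complement (scaled_tan n alpha) (scaled_tan n \o a) (scaled_tan n \o b) =
  scaled_tan n @` gap_complement alpha a b.
Proof.
apply/seteqP; split=> [v|_ [k /gap_complementE[kal kI] <-]].
  move=> /gap_complementE[/andP[v1 v2] vI]; exists (scaled_atan n v).
    apply/gap_complementE; split.
      move: v1 v2; rewrite -scaled_tanN !leNgt lt_scaled_tanl // lt_scaled_tanr //.
      by move=> -> ->.
    move=> i; have [ai _ bi] := bnd_gap i.
    by rewrite -lt_scaled_tanl // -lt_scaled_tanr //; exact: vI.
  exact: scaled_atanK.
apply/gap_complementE; split=> [|i].
  rewrite -scaled_tanN !leNgt !lt_scaled_tanl // !scaled_tanK //.
  by rewrite -!leNgt.
have [ai _ bi] := bnd_gap i.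
by rewrite /= !lt_scaled_tanl // !scaled_tanK //; exact: kI.
Qed.

Lemma stretch_scaled_ray (p : R * R * R) k : - alpha <= k <= alpha ->
  stretch n%:R^-1 n%:R @` angle_ray p (k / n%:R ^+ 2) =
  slope_ray (stretch n%:R^-1 n%:R p) (scaled_tan n k).
Proof. by move=> kal; rewrite stretch_angle_ray // cos_scaled_angle. Qed.

End Scaled.

Lemma Sn_gap_surface (alpha : R) n (I : Type) (a b : I -> R) :
  Num.sqrt alpha < n%:R ->
  marked_gaps alpha a (fun i => midpoint (a i) (b i)) b ->
  Sn alpha a b n =
  gap_surface (scaled_tan n alpha) (scaled_tan n \o a)
    (fun i => scaled_tan n (midpoint (a i) (b i))) (scaled_tan n \o b).
Proof.
move=> alpha_n gaps; have [alpha0 ab amb _] := gaps.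
have n0 : (0 < n)%N.
  by rewrite -(@ltr0n R); apply: le_lt_trans alpha_n; exact: sqrtr_ge0.
have bal : - alpha <= alpha <= alpha by apply/andP; split; lra.
have bnal : - alpha <= - alpha <= alpha by apply/andP; split; lra.
have bnd i : [/\ - alpha <= a i <= alpha,
    - alpha <= midpoint (a i) (b i) <= alpha & - alpha <= b i <= alpha].
  have [? ?] := ab i; have /andP[? ?] := amb i.
  by split; apply/andP; split; lra.
pose s : R * R * R -> R * R * R := stretch n%:R^-1 n%:R.
have ray p k : - alpha <= k <= alpha ->
    s @` angle_ray p (k / n%:R ^+ 2) = slope_ray (s p) (scaled_tan n k).
  by move=> kal; exact: (stretch_scaled_ray alpha0 alpha_n).
have ray0 k : - alpha <= k <= alpha ->
    s @` angle_ray horigin (k / n%:R ^+ 2) = slope_ray horigin (scaled_tan n k).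
  by move=> kal; rewrite ray // /s stretch_horigin.
have mid i : midpoint (a i / n%:R ^+ 2) (b i / n%:R ^+ 2) =
    midpoint (a i) (b i) / n%:R ^+ 2 by rewrite /midpoint; ring.
(* The arc [None] yields the fan of the negative x-axis: its midpoint is pi, and its ends give the
   slopes of opposite signs. *)
have mid0 : midpoint (alpha / n%:R ^+ 2) (2 * pi - alpha / n%:R ^+ 2) = pi.
  by rewrite /midpoint addrC subrK; field.
have rayN p : s @` angle_ray p (2 * pi - alpha / n%:R ^+ 2) =
    slope_ray (s p) (- scaled_tan n alpha).
  by rewrite angle_ray_2pi -mulNr ray // scaled_tanN.
have bigcup_option (F : option I -> set (R * R * R)) :
    \bigcup_j F j = F None `|` \bigcup_i F (Some i).
  apply/seteqP; split=> [p [[i|] _ ?]|p [?|[i _ ?]]].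
  - by right; exists i.
  - by left.
  - by exists None.
  - by exists (Some i).
(* Image of a primary ray together with the two families of rays issued from it. *)
have fan theta t1 t2 c1 c2 (T : set (R * R * R)) :
    s @` angle_ray horigin theta = T ->
    (forall p, s @` angle_ray p t1 = slope_ray (s p) c1) ->
    (forall p, s @` angle_ray p t2 = slope_ray (s p) c2) ->
    s @` (\bigcup_(p in angle_ray horigin theta)
            (angle_ray p t1 `|` angle_ray p t2)) =
    \bigcup_(p in T) (slope_ray p c1 `|` slope_ray p c2).
  move=> <- h1 h2; rewrite image_bigcup bigcup_image.
  by apply: eq_bigcupr => p _; rewrite image_setU h1 h2.
have KE : \bigcup_(k in Kscaled alpha a b n) s @` angle_ray horigin k =
    \bigcup_(k in gap_complement (scaled_tan n alpha) (scaled_tan n \o a)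
       (scaled_tan n \o b)) slope_ray horigin k.
  rewrite (gap_complement_scaled alpha0 alpha_n gaps) !bigcup_image.
  by apply: eq_bigcupr => k /gap_complementE[kal _]; exact: ray0.
rewrite /Sn /Sigma -/s !image_setU !image_bigcup KE !bigcup_option /= !mid0.
have pi_ray : s @` angle_ray horigin pi = neg_x_axis by exact: stretch_angle_ray_pi.
rewrite (fan _ _ _ _ _ _ pi_ray (fun p => ray p _ bal) rayN) pi_ray.
rewrite /gap_surface.
have -> : \bigcup_i s @` angle_ray horigin (midpoint (a i / n%:R ^+ 2) (b i / n%:R ^+ 2)) =
    \bigcup_i slope_ray horigin (scaled_tan n (midpoint (a i) (b i))).
  by apply: eq_bigcupr => i _; rewrite mid; have [_ ? _] := bnd i; exact: ray0.
rewrite !setUA [X in X `|` _ `|` _ `|` _]setUC; congr (_ `|` _).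
apply: eq_bigcupr => i _; have [ai mi bi] := bnd i.
by apply: fan => [|p|p]; [rewrite mid; exact: ray0|exact: ray|exact: ray].
Qed.

End Stretch.

(** * Application to [Lambda] and [Sn] *)

Lemma LambdaE (R : realType) (I : Type) (alpha : R) (a b : I -> R) :
  Lambda alpha a b = gap_surface alpha a (fun i => midpoint (a i) (b i)) b.
Proof. by []. Qed.

Lemma marked_gaps_midpoint (R : realType) (I : Type) (alpha : R) (a b : I -> R) :
  0 < alpha -> (forall i, a i < b i) ->
  (forall i, [set` `]a i, b i[] `<=` [set` `[- alpha, alpha]]) ->
  trivIset setT (fun i => [set` `]a i, b i[]) ->
  marked_gaps alpha a (fun i => midpoint (a i) (b i)) b.
Proof.
move=> alpha0 ab sub disj; split=> // [i|i|i j v vi vj].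
- have abi := ab i; have sup v : a i < v < b i -> - alpha <= v <= alpha.
    by move=> vi; have := sub i v; rewrite /= !in_itv; exact.
  (* If an end leaves [-alpha, alpha], part of the open gap does too; a point of that part
     contradicts the inclusion. *)
  split; rewrite leNgt; apply/negP => h.
    have [m|m] := leP (- alpha) (b i).
      by have /andP[] := sup ((a i - alpha) / 2) (ltac:(apply/andP; split; lra)); lra.
    by have /andP[] := sup ((a i + b i) / 2) (ltac:(apply/andP; split; lra)); lra.
  have [m|m] := leP (a i) alpha.
    by have /andP[] := sup ((b i + alpha) / 2) (ltac:(apply/andP; split; lra)); lra.
  by have /andP[] := sup ((a i + b i) / 2) (ltac:(apply/andP; split; lra)); lra.
- by rewrite /midpoint; have := ab i => ?; apply/andP; split; lra.
- by apply: disj => //; exists v; rewrite /= !in_itv.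
Qed.

Unset Implicit Arguments.

Theorem proposition1p3 (R : realType) (alpha : R) (I : countType) (a b : I -> R)
    (alpha_gt0 : 0 < alpha)
    (ab_nonempty : forall i, a i < b i)
    (ab_sub : forall i, [set` `]a i, b i[] `<=` [set` `[- alpha, alpha]])
    (ab_disjoint : trivIset setT (fun i => [set` `]a i, b i[])) :
  [/\ forall n : nat, Num.sqrt alpha < n%:R ->
        locally_L1 (\1_(epigraph (Sn alpha a b n))),
      locally_L1 (\1_(epigraph (Lambda alpha a b))) &
      cvg_L1loc (fun n => \1_(epigraph (Sn alpha a b n)))
        (\1_(epigraph (Lambda alpha a b)))].
Proof.
have gaps := marked_gaps_midpoint alpha_gt0 ab_nonempty ab_sub ab_disjoint.
have gaps_ n (hn : Num.sqrt alpha < n%:R) := marked_gaps_scaled alpha_gt0 hn gaps.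
have near_n : \forall n \near \oo, Num.sqrt alpha < n%:R.
  exact: (cvgry_gt cvgr_idn).
split=> [n hn C cC|C cC|].
- apply: integrable_indic_compact => //; rewrite Sn_gap_surface //.
  exact: measurable_epigraph_gap_surface (gaps_ n hn).
- apply: integrable_indic_compact => //; rewrite LambdaE.
  exact: measurable_epigraph_gap_surface.
rewrite LambdaE.
apply: (cvg_L1loc_gap_surface gaps (alpha_ := fun n => scaled_tan n alpha)
  (a_ := fun n => scaled_tan n \o a) (b_ := fun n => scaled_tan n \o b)
  (m_ := fun n i => scaled_tan n (midpoint (a i) (b i)))).
- by near=> n; apply: gaps_; near: n.
- exact: cvg_scaled_tan.
- by move=> i; exact: cvg_scaled_tan.
- by move=> i; exact: cvg_scaled_tan.
- by move=> i; exact: cvg_scaled_tan.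
(* Each [k] in [K] is approximated by its own rescaled slope. *)
- move=> k Kk; exists (fun n => scaled_tan n k); last exact: cvg_scaled_tan.
  near=> n; have hn : Num.sqrt alpha < n%:R by near: n.
  by rewrite (gap_complement_scaled alpha_gt0 hn gaps); exists k.
- near=> n; apply: Sn_gap_surface => //.
  by near: n.
Unshelve. all: by end_near. Qed.
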